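(* For each integer $g \ge 2$ with $g \notin \{3,5,7,9,11,13\}$, there exists a $\mathrm{GDD}(5,6,11g+7g)$ of type $g^{11}(7g)^1$ and there exists a $\mathrm{GDD}(6,7,12g+7g)$ of type $g^{12}(7g)^1$.
   Context: A group divisible design $\mathrm{GDD}(t,k,m)$ of type $g_1^{n_1} g_2^{n_2}\cdots g_r^{n_r}$, where $t \ge 2$ and $m=\sum_{i=1}^r n_i g_i$, is a triple $(X,G,B)$ such that $X$ is a set of $m$ points; $G$ is a partition of $X$ into $n=\sum_{i=1}^r n_i$ groups, of which $n_i$ have exactly $g_i$ points, $1\le i\le r$; $B$ is a set of $k$-subsets of $X$ (blocks); each block contains at most one point from each group; and each $t$-subset of $X$ which contains at most one point from each group is contained in exactly one block of $B$. *)

(* Defs.v *)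
From mathcomp Require Import all_boot.

Set Implicit Arguments.
Unset Strict Implicit.
Unset Printing Implicit Defensive.

Definition transverse (X : finType) (G : {set {set X}}) (S : {set X}) : Prop :=
  forall A : {set X}, A \in G -> #|S :&: A| <= 1.

(* A type g_1^{n_1} ... g_r^{n_r} is encoded as [:: (g_1, n_1); ...; (g_r, n_r)]. *)
Definition gdd_type := seq (nat * nat).

Definition type_sizes (ty : gdd_type) : seq nat :=
  flatten [seq nseq p.2 p.1 | p <- ty].

(* The group sizes are compared as multisets, so that the definition is also
   meaningful when some g_i coincide. *)
Record is_GDD (t k m : nat) (ty : gdd_type)
    (X : finType) (G B : {set {set X}}) : Prop := IsGDD {
  gdd_t_ge2 : 2 <= t;
  gdd_m : m = \sum_(p <- ty) p.2 * p.1;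
  gdd_points : #|X| = m;
  gdd_partition : partition G [set: X];
  gdd_groups : perm_eq [seq #|A| | A : {set X} in G] (type_sizes ty);
  gdd_blocks : forall b : {set X}, b \in B -> #|b| = k;
  gdd_block_transverse : forall b : {set X}, b \in B -> transverse G b;
  gdd_cover : forall T : {set X}, #|T| = t -> transverse G T ->
    exists! b : {set X}, b \in B /\ T \subset b
}.

Definition GDD_exists (t k m : nat) (ty : gdd_type) : Prop :=
  exists (X : finType) (G B : {set {set X}}), is_GDD t k m ty G B.

(* Main.v *)
Require Import Defs.
From mathcomp Require Import all_boot all_algebra.

(** Both designs come from one combinatorial object: a list of [7 * g] Steiner
    systems S(5,6,12) on the same 12 points such that every 6-subset of the
    points is a block of exactly [g] of them ([large_set 5 g]).  For [g = 1] this
    would be a genuine large set of S(5,6,12), which is impossible since at most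
    two such systems are disjoint; with repetitions allowed the obstruction
    disappears.

    From such a list [Ds] one builds a design of type g^12 (7g)^1 as follows
    ([GDD_of_large_set]).  Give each of the 12 groups the elements of Z/g, and
    name the points of the last group by the positions [c] in [Ds].  A 6-set
    [K] of groups occurs at exactly [g] positions; number these 0, ..., g-1 in
    increasing order, and let [rank K c] be the number given to [c].  The blocks
    are the sets consisting of [c] and of the graph of a function [f] on [K],
    where [K] is a block of the system at [c] and the sum of the values of [f]
    is [rank K c] mod g.  A transverse 6-set that avoids the last group is the
    graph of some [f] on some [K], and its sum picks out a single position [c].
    A transverse 6-set through [c] is [c] plus a graph over a 5-set [S]; the
    Steiner property gives the only block [K] of the system at [c] that contains
    [S], and the prescribed sum gives the value at the sixth element of [K].

    The blocks through one point of an S(5,6,12), with that point removed, form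
    an S(4,5,11), and taking these derived systems throughout preserves the
    multiplicity [g] ([large_set_derived]).  Hence the same construction gives
    the design of type g^11 (7g)^1.

    Concatenating two lists adds their multiplicities ([large_set_cat]), so it
    is enough to have lists for [g = 2] and [g = 3].  These are [large_2] and
    [large_3]: relabellings of the system [hexads] of the squares modulo 11,
    verified by computation. *)

Set Implicit Arguments.
Unset Strict Implicit.
Unset Printing Implicit Defensive.

Import GRing.Theory.

(** * Steiner systems and repeated large sets *)

(** The Steiner systems S(t, t+1, v), with [v] the number of elements of [V]. *)
Definition steiner (V : finType) (t : nat) (D : {set {set V}}) : Prop :=
  (forall b, b \in D -> #|b| = t.+1) /\
  (forall T : {set V}, #|T| = t -> exists! b, b \in D /\ T \subset b).

(** A list rather than a set, as a system may have to be repeated.  For [g = 1]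
    these are the large sets of disjoint Steiner systems. *)
Definition large_set (V : finType) (t g : nat) (Ds : seq {set {set V}}) :
    Prop :=
  (forall D, D \in Ds -> steiner t D) /\
  (forall K : {set V}, #|K| = t.+1 ->
     count (fun D : {set {set V}} => K \in D) Ds = g).

Lemma large_set_cat (V : finType) t g1 g2 (Ds1 Ds2 : seq {set {set V}}) :
  large_set t g1 Ds1 -> large_set t g2 Ds2 ->
  large_set t (g1 + g2) (Ds1 ++ Ds2).
Proof.
move=> [st1 cnt1] [st2 cnt2]; split=> [D | K cardK].
  by rewrite mem_cat => /orP[/st1 | /st2].
by rewrite count_cat cnt1 ?cnt2.
Qed.

(** * Positions of the elements of a list that satisfy a predicate *)

Lemma count_take_index (A : Type) (a : pred A) (x0 : A) (s : seq A) (r : nat) :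
  r < count a s ->
  exists i, [/\ i < size s, a (nth x0 s i) & count a (take i s) = r].
Proof.
elim: s r => [|x s IHs] r //=.
case ax: (a x) => /=; last first.
  by case/IHs=> i [lt_i a_i cnt_i]; exists i.+1; rewrite /= ax.
case: r => [_|r]; first by exists 0; rewrite /= ax.
rewrite add1n ltnS => /IHs[i [lt_i a_i cnt_i]].
by exists i.+1; rewrite /= ax cnt_i.
Qed.

Lemma count_take_lt (A : Type) (a : pred A) (x0 : A) (s : seq A) (i j : nat) :
  i < j -> i < size s -> a (nth x0 s i) ->
  count a (take i s) < count a (take j s).
Proof.
elim: s i j => [|x s IHs] [|i] [|j] //=; first by move=> _ _ ->.
by move=> lt_ij lt_i a_i; rewrite ltn_add2l IHs.
Qed.

(** * The group divisible design of a repeated large set *)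

Section DesignFromLargeSet.

(* The number g is a successor so that 'I_g is an additive group. *)
Variables (V : finType) (t g' : nat) (Ds : seq {set {set V}}).
Local Notation g := (g'.+1).
Local Notation N := (size Ds).
Hypothesis N_gt0 : 0 < N.
Hypothesis large_Ds : large_set t g Ds.

Local Notation X := (V * 'I_g + 'I_N)%type.

Definition group_of (x : X) : option V := if x is inl p then Some p.1 else None.

Definition fiber (o : option V) : {set X} := [set x | group_of x == o].

Definition groups : {set {set X}} := [set fiber o | o : option V].

Definition graph (K : {set V}) (f : {ffun V -> 'I_g}) : {set X} :=
  [set (inl (i, f i) : X) | i in K].

Definition rank (K : {set V}) (c : nat) : nat :=
  count (fun D : {set {set V}} => K \in D) (take c Ds).

(** A triple [(c, K, f)] stands for the point [c] of the last group together
    with the graph of the restriction of [f] to [K]. *)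
Definition block (u : 'I_N * {set V} * {ffun V -> 'I_g}) : {set X} :=
  (inr u.1.1 : X) |: graph u.1.2 u.2.

Definition admissible (u : 'I_N * {set V} * {ffun V -> 'I_g}) : bool :=
  (u.1.2 \in nth set0 Ds u.1.1) &&
  ((\sum_(i in u.1.2) u.2 i)%R == inord (rank u.1.2 u.1.1)).

Definition blocks : {set {set X}} := [set block u | u in admissible].

Lemma mem_graph_inl K f i y :
  ((inl (i, y) : X) \in graph K f) = (i \in K) && (y == f i).
Proof.
apply/imsetP/andP=> [[j Kj [-> ->]]|[Ki /eqP->]]; first by rewrite Kj eqxx.
by exists i.
Qed.

Lemma mem_graph_inr K f c : ((inr c : X) \in graph K f) = false.
Proof. by apply/imsetP=> -[]. Qed.

Lemma card_graph K f : #|graph K f| = #|K|.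
Proof. by rewrite card_imset // => i j []. Qed.

Lemma graph_subset K f K' f' :
  graph K f \subset graph K' f' -> K \subset K' /\ {in K, f =1 f'}.
Proof.
move=> /subsetP sub; have sub_at i : i \in K -> (i \in K') && (f i == f' i).
  by move=> Ki; rewrite -mem_graph_inl sub // mem_graph_inl Ki /=.
by split=> [|i /sub_at/andP[_ /eqP]] //; apply/subsetP=> i /sub_at/andP[].
Qed.

Lemma eq_graph (K : {set V}) (f f' : {ffun V -> 'I_g}) :
  {in K, f =1 f'} -> graph K f = graph K f'.
Proof. by move=> eq_f; apply: eq_in_imset => i Ki; rewrite eq_f. Qed.

Lemma transverseP (S : {set X}) :
  transverse groups S <-> {in S &, injective group_of}.
Proof.
split=> [trS x y Sx Sy eq_xy | injS A /imsetP[o _ ->]].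
  have /trS/card_le1_eqP le1 : fiber (group_of x) \in groups by apply: imset_f.
  by apply: le1; rewrite !inE ?Sx ?Sy ?eq_xy eqxx.
apply/card_le1_eqP=> x y; rewrite !inE => /andP[Sx /eqP ox] /andP[Sy /eqP oy].
by apply: injS => //; rewrite ox oy.
Qed.

(** A transverse set has at most one point over each element of [V], so it is
    the graph of a partial function up to a point of the last group. *)
Lemma transverse_graph (S : {set X}) : transverse groups S ->
  exists K f, S = graph K f \/ exists c, S = (inr c : X) |: graph K f.
Proof.
move=> /transverseP injS.
pose f := [ffun i : V => odflt ord0 [pick y | (inl (i, y) : X) \in S]].
pose K := [set i | [exists y, (inl (i, y) : X) \in S]].
have inlE i y : ((inl (i, y) : X) \in S) = (i \in K) && (y == f i).
  rewrite inE ffunE; case: pickP => [z Sz | noS] /=; last first.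
    rewrite noS; apply/esym/andP=> -[/existsP[z]]; by rewrite noS.
  apply/idP/andP=> [Sy | [_ /eqP->] //].
    split; first by apply/existsP; exists y.
  by have [->] := injS _ _ Sy Sz erefl.
exists K, f.
case: (pickP (fun c => (inr c : X) \in S)) => [c Sc | noc];
  [right; exists c | left];
  apply/setP=> -[[i y]|c'];
  rewrite ?inE ?mem_graph_inl ?mem_graph_inr ?inlE ?orbF //.
by apply/idP/eqP=> [Sc'|[->] //]; exact: (injS _ _ Sc' Sc).
Qed.

Lemma steiner_nth (c : 'I_N) : steiner t (nth set0 Ds c).
Proof. by case: large_Ds => stD _; apply/stD/mem_nth. Qed.

(** A set [K] of [t.+1] elements lies in [g] of the systems, so the ranks of
    these systems are 0, ..., g-1, each taken once: this is the content of the
    next four lemmas. *)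
Lemma rank_lt (K : {set V}) (c : 'I_N) :
  #|K| = t.+1 -> K \in nth set0 Ds c -> rank K c < g.
Proof.
case: large_Ds => _ cnt cardK Kc; rewrite -(cnt K cardK) /rank.
by rewrite -[X in _ < count _ X](take_size Ds) (count_take_lt (x0 := set0)).
Qed.

Lemma rank_inj (K : {set V}) (c c' : 'I_N) :
  K \in nth set0 Ds c -> K \in nth set0 Ds c' -> rank K c = rank K c' -> c = c'.
Proof.
move=> Kc Kc' eq_r; apply/val_inj.
case: (ltngtP c c') => // [lt_c|lt_c].
  suff: rank K c < rank K c' by rewrite eq_r ltnn.
  exact: (count_take_lt (x0 := set0)).
suff: rank K c' < rank K c by rewrite eq_r ltnn.
exact: (count_take_lt (x0 := set0)).
Qed.

Lemma inord_rank_inj (K : {set V}) (c c' : 'I_N) : #|K| = t.+1 ->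
  K \in nth set0 Ds c -> K \in nth set0 Ds c' ->
  inord (rank K c) = inord (rank K c') :> 'I_g -> c = c'.
Proof.
move=> cardK Kc Kc' /(congr1 val); rewrite /= !inordK ?rank_lt //.
exact: rank_inj.
Qed.

Lemma rank_onto (K : {set V}) (s : 'I_g) : #|K| = t.+1 ->
  exists c : 'I_N, K \in nth set0 Ds c /\ inord (rank K c) = s.
Proof.
case: large_Ds => _ cnt cardK.
have lt_s : s < count (fun D : {set {set V}} => K \in D) Ds.
  by rewrite (cnt K cardK).
have [i [lt_i Ki rk]] := count_take_index set0 lt_s.
by exists (Ordinal lt_i); split=> //; rewrite /rank rk inord_val.
Qed.

Lemma card_block_support u : admissible u -> #|u.1.2| = t.+1.
Proof. by case/andP=> Kc _; case: (steiner_nth u.1.1) => /(_ _ Kc). Qed.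

Lemma card_block u : admissible u -> #|block u| = t.+2.
Proof.
by move=> gu; rewrite cardsU1 mem_graph_inr card_graph card_block_support.
Qed.

Lemma transverse_block u : transverse groups (block u).
Proof.
apply/transverseP=> -[[i y]|c] [[j z]|c'];
  rewrite !inE ?mem_graph_inl ?mem_graph_inr ?orbF //=.
  by move=> /andP[_ /eqP->] /andP[_ /eqP->] [->].
by move=> /eqP[->] /eqP[->].
Qed.

Lemma graph_sub_block K f u :
  graph K f \subset block u -> K \subset u.1.2 /\ {in K, f =1 u.2}.
Proof.
move=> /subsetP sub; apply: graph_subset; apply/subsetP=> -[[i y]|c] xK.
  by have:= sub _ xK; rewrite !inE.
by move: xK; rewrite mem_graph_inr.
Qed.

(** The sum of [f] over [K] is the rank of exactly one system containing [K]. *)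
Lemma cover_graph (K : {set V}) f : #|K| = t.+1 ->
  exists! b, b \in blocks /\ graph K f \subset b.
Proof.
move=> cardK; have [c [Kc rk]] := rank_onto (\sum_(i in K) f i)%R cardK.
exists (block (c, K, f)); split.
  split; last exact: subsetUr.
  by apply: imset_f; rewrite unfold_in /admissible /= Kc /= rk eqxx.
move=> _ [/imsetP[u gu ->]] /graph_sub_block[sKu eq_f].
have eqK : K = u.1.2.
  by apply/eqP; rewrite eqEcard sKu cardK (card_block_support gu) leqnn.
move: u gu eqK eq_f {sKu} => [[c' K'] f'] /andP[/= Kc' /eqP sum_f'] eqK eq_f.
rewrite -{}eqK in Kc' sum_f' *.
rewrite /block /= (eq_graph eq_f); congr (inr _ |: _).
apply: (inord_rank_inj cardK Kc Kc'); rewrite rk -sum_f'.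
by apply: eq_bigr => i /eq_f.
Qed.

(** The system at [c] has one block [K] containing [S], and [K] has a single
    further element [j]; the value at [j] is forced by the prescribed sum. *)
Lemma cover_inr (c : 'I_N) (S : {set V}) f : #|S| = t ->
  exists! b, b \in blocks /\ (inr c : X) |: graph S f \subset b.
Proof.
move=> cardS; have [cardD covD] := steiner_nth c.
have [K [[Kc sSK] uniqK]] := covD S cardS.
have cardK := cardD K Kc.
have /cards1P[j defj] : #|K :\: S| == 1.
  by rewrite cardsD (setIidPr sSK) cardK cardS subSnn.
have jNS : j \notin S.
  by have: j \in K :\: S; [rewrite defj set11 | case/setDP].
have defK : K = j |: S by rewrite -(setID K S) (setIidPr sSK) defj setUC.
have sumK (h : {ffun V -> 'I_g}) :
    (\sum_(i in K) h i = h j + \sum_(i in S) h i)%R by rewrite defK big_setU1.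
pose r : 'I_g := inord (rank K c).
pose h := [ffun i => if i == j then (r - \sum_(k in S) f k)%R else f i].
have eq_h : {in S, h =1 f}.
  by move=> i Si; rewrite ffunE; case: eqP jNS => // <-; rewrite Si.
exists (block (c, K, h)); split.
  split.
    apply: imset_f; rewrite unfold_in /admissible /= Kc sumK ffunE eqxx /=.
    by rewrite (eq_bigr _ eq_h) subrK.
  by apply: setUS; rewrite -(eq_graph eq_h); apply: imsetS.
move=> _ [/imsetP[[[c' K'] h'] /andP[/= Kc' /eqP sum_h'] ->]].
rewrite subUset sub1set !inE mem_graph_inr orbF => /andP[/eqP[cc'] sub].
have [/= sSK' eq_h'] := graph_sub_block sub.
rewrite -{}cc' in Kc' sum_h' *.
have eqK : K = K' by apply: uniqK.
rewrite -{}eqK in Kc' sum_h' *.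
congr (_ |: _); apply: eq_graph => i; rewrite defK 2!inE.
case/orP=> [/eqP-> | Si]; last by rewrite eq_h // eq_h'.
rewrite ffunE eqxx /r -sum_h' sumK (eq_bigr (fun i => h' i) eq_h').
by rewrite addrK.
Qed.

Lemma group_of_onto o : exists x, group_of x = o.
Proof.
by case: o => [i|]; [exists (inl (i, ord0)) | exists (inr (Ordinal N_gt0))].
Qed.

Lemma fiber_inj : injective fiber.
Proof.
move=> o o' /setP eq_oo'; have [x ox] := group_of_onto o.
by have := eq_oo' x; rewrite !inE ox eqxx => /esym/eqP.
Qed.

Lemma groups_partition : partition groups [set: X].
Proof.
have -> : groups = preim_partition group_of setT; last exact: preim_partitionP.
apply/setP=> A; apply/imsetP/imsetP=> [[o _ ->]|[x _ ->]].
  have [x <-] := group_of_onto o; exists x => //.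
  by apply/setP=> y; rewrite !inE eq_sym.
by exists (group_of x) => //; apply/setP=> y; rewrite !inE eq_sym.
Qed.

Lemma card_fiber o : #|fiber o| = if o is Some _ then g else N.
Proof.
case: o => [i|].
  have -> : fiber (Some i) = [set inl (i, y) | y : 'I_g].
    apply/setP=> x; rewrite inE; apply/eqP/imsetP=> [|[y _ ->]] //.
    by case: x => [[j y]|//] [->]; exists y.
  by rewrite card_imset ?card_ord // => y z [].
have -> : fiber None = [set inr c | c : 'I_N].
  apply/setP=> x; rewrite inE; apply/eqP/imsetP=> [|[c _ ->]] //.
  by case: x => [//|c] _; exists c.
by rewrite card_imset ?card_ord // => y z [].
Qed.

Lemma groups_sizes :
  perm_eq [seq #|A| | A : {set X} in groups] (nseq #|V| g ++ [:: N]).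
Proof.
pose os : seq (option V) := rcons (map Some (enum V)) None.
have mem_os o : o \in os.
  rewrite mem_rcons inE; case: o => [i|] //=.
  by rewrite mem_map ?mem_enum // => ? ? [].
have uniq_os : uniq os.
  rewrite rcons_uniq map_inj_uniq ?enum_uniq ?andbT; last by move=> ? ? [].
  by apply/mapP=> -[].
have enum_groups : perm_eq (enum groups) (map fiber os).
  apply: uniq_perm; rewrite ?enum_uniq ?(map_inj_uniq fiber_inj) //.
  move=> A; rewrite mem_enum; apply/imsetP/mapP=> -[o _ ->]; exists o => //.
apply: perm_trans (perm_map _ enum_groups) _.
rewrite -map_comp map_rcons /= card_fiber -map_comp -cats1.
rewrite (eq_map (g := fun=> g)); last by move=> i; rewrite /= card_fiber.
suff -> : [seq g | _ <- enum V] = nseq #|V| g by [].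
by rewrite cardE; elim: (enum V) => //= i s ->.
Qed.

Theorem GDD_of_large_set : 0 < t ->
  GDD_exists t.+1 t.+2 (#|V| * g + N) [:: (g, #|V|); (N, 1)].
Proof.
move=> t_gt0; exists X, groups, blocks; split.
- by [].
- by rewrite !big_cons big_nil /= addn0 mul1n.
- by rewrite card_sum card_prod !card_ord.
- exact: groups_partition.
- exact: groups_sizes.
- by move=> _ /imsetP[u gu ->]; apply: card_block.
- by move=> _ /imsetP[u _ ->]; apply: transverse_block.
move=> T cardT /transverse_graph[K [f [defT | [c defT]]]];
  rewrite defT in cardT *.
  by apply: cover_graph; rewrite -cardT card_graph.
apply: cover_inr.
by move: cardT; rewrite cardsU1 mem_graph_inr card_graph => -[].
Qed.

End DesignFromLargeSet.

(** * Derived systems *)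

Section Derived.

Variable v : nat.

Definition cone (K : {set 'I_v}) : {set 'I_v.+1} := ord0 |: lift ord0 @: K.

(** The blocks through the point [ord0], with this point removed. *)
Definition derived (D : {set {set 'I_v.+1}}) : {set {set 'I_v}} :=
  cone @^-1: D.

Lemma mem_cone K i : (lift ord0 i \in cone K) = (i \in K).
Proof. by rewrite !inE /= mem_imset //; apply: lift_inj. Qed.

Lemma card_cone K : #|cone K| = #|K|.+1.
Proof.
rewrite cardsU1 card_imset; last exact: lift_inj.
by case: imsetP => // -[i _ /eqP]; rewrite eqE.
Qed.

Lemma cone_subset K L : (cone K \subset cone L) = (K \subset L).
Proof.
apply/subsetP/subsetP=> sub x.
  by rewrite -mem_cone => /sub; rewrite mem_cone.
case: (unliftP ord0 x) => [i|] ->; last by rewrite !setU11.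
by rewrite !mem_cone => /sub.
Qed.

Lemma cone_inj : injective cone.
Proof. by move=> K L eqKL; apply/setP=> i; rewrite -!mem_cone eqKL. Qed.

Lemma coneP (b : {set 'I_v.+1}) : ord0 \in b -> exists K, b = cone K.
Proof.
move=> b0; exists [set i | lift ord0 i \in b]; apply/setP=> x.
by case: (unliftP ord0 x) => [i|] ->; rewrite ?mem_cone ?inE // eqxx b0.
Qed.

Lemma steiner_derived t D : steiner t.+1 D -> steiner t (derived D).
Proof.
move=> [cardD covD]; split=> [K | T cardT].
  by rewrite inE => /cardD; rewrite card_cone => -[].
have [|b [[Db sTb] uniq_b]] := covD (cone T); first by rewrite card_cone cardT.
have [K defb] : exists K, b = cone K by apply/coneP/(subsetP sTb)/setU11.
rewrite defb cone_subset in Db sTb uniq_b.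
exists K; split; first by rewrite inE.
by move=> L []; rewrite inE -cone_subset => DL sTL; apply/cone_inj/uniq_b.
Qed.

Lemma large_set_derived t g Ds :
  large_set t.+1 g Ds -> large_set t g (map derived Ds).
Proof.
move=> [stDs cntDs]; split=> [_ /mapP[D /stDs stD ->] | K cardK].
  exact: steiner_derived.
rewrite count_map -(cntDs (cone K)) ?card_cone ?cardK //.
by apply: eq_count => D; rewrite /= inE.
Qed.

End Derived.

(** * Systems given by lists of lists of numbers *)

(** Decides whether every [t]-subset of {0, ..., v-1} lies in exactly [lam]
    members of [l].  The elements of the subset are chosen from the largest one
    down, and [l] is filtered along the way, so that the common prefixes of the
    subsets are treated once. *)
Fixpoint covers (lam v t : nat) (l : seq (seq nat)) : bool :=
  match t, v with
  | 0, _ => size l == lam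
  | _.+1, 0 => true
  | t'.+1, v'.+1 =>
      covers lam v' t l && covers lam v' t' [seq s <- l | v' \in s]
  end.

Section Lists.

Variable v : nat.

Definition points (s : seq nat) : {set 'I_v} := [set i | val i \in s].

Lemma coversP lam t l (T : {set 'I_v}) :
  covers lam v t l -> #|T| = t -> count (fun s => T \subset points s) l = lam.
Proof.
suff gen n : covers lam n t l -> (forall i, i \in T -> i < n) -> #|T| = t ->
    count (fun s => T \subset points s) l = lam.
  by move/gen; apply=> i _; apply: ltn_ord.
have count_set0 l' : count (fun s => set0 \subset points s) l' = size l'.
  rewrite -(count_predT l'); apply: eq_count => s; exact: sub0set.
elim: n t l T => [|n IHn] [|t] l T /=.
- by move=> /eqP <- _ /cards0_eq->; apply: count_set0.
- move=> _ lt_T cardT; have /card_gt0P[i] : 0 < #|T| by rewrite cardT.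
  by move/lt_T.
- by move=> /eqP <- _ /cards0_eq->; apply: count_set0.
case/andP=> cov_without cov_with lt_T cardT.
case: (pickP (fun i => (i \in T) && (val i == n)))
  => [i /andP[Ti /eqP def_n] | noT].
  have cardT' : #|T :\ i| = t by move: cardT; rewrite (cardsD1 i T) Ti => -[].
  rewrite -{cov_with}(IHn _ _ (T :\ i) cov_with) //.
    rewrite count_filter; apply: eq_count => s /=.
    by rewrite -{1}(setD1K Ti) subUset sub1set inE def_n andbC.
  move=> j /setD1P[ne_ji /lt_T]; rewrite ltnS leq_eqVlt -def_n.
  case/predU1P=> [/val_inj eq_ji|//].
  by rewrite eq_ji eqxx in ne_ji.
apply: IHn cov_without _ cardT => j Tj; have := lt_T j Tj.
rewrite ltnS leq_eqVlt => /predU1P[eq_jn|//].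
by have := noT j; rewrite /= Tj eq_jn eqxx.
Qed.

Definition system (l : seq (seq nat)) : {set {set 'I_v}} :=
  [set K | K \in map points l].

Definition steiner_list (t : nat) (l : seq (seq nat)) : bool :=
  all (fun s => [&& uniq s, size s == t.+1 & all (gtn v) s]) l &&
  covers 1 v t l.

Lemma card_points s : uniq s -> all (gtn v) s -> #|points s| = size s.
Proof.
move=> uniq_s /allP lt_s; rewrite cardE -(size_map val).
apply/perm_size/uniq_perm=> //.
  by rewrite (map_inj_uniq val_inj) enum_uniq.
move=> x; apply/mapP/idP=> [[i]|sx]; first by rewrite mem_enum inE => ? ->.
by exists (Ordinal (lt_s x sx)); rewrite ?mem_enum ?inE.
Qed.

Lemma count1_inj (A : eqType) (a : pred A) l x y :
  count a l = 1 -> x \in l -> y \in l -> a x -> a y -> x = y.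
Proof.
rewrite -size_filter => sz lx ly ax ay.
have: x \in filter a l by rewrite mem_filter ax.
have: y \in filter a l by rewrite mem_filter ay.
by case: (filter a l) sz => [|z []] //= _; rewrite !inE => /eqP-> /eqP->.
Qed.

Lemma card_system t l K : steiner_list t l -> K \in system l -> #|K| = t.+1.
Proof.
case/andP=> /allP wf _; rewrite inE => /mapP[s /wf/and3P[us /eqP <- lt_s] ->].
exact: card_points.
Qed.

Lemma steiner_system t l : steiner_list t l -> steiner t (system l).
Proof.
move=> st_l; split=> [b|T cardT]; first exact: card_system.
have cnt := coversP (proj2 (andP st_l)) cardT.
have /hasP[s ls sTs] : has (fun s => T \subset points s) l.
  by rewrite has_count cnt.
exists (points s); split; first by rewrite inE map_f.
move=> b []; rewrite inE => /mapP[s' ls' ->] sTs'.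
by congr points; apply: count1_inj cnt ls ls' sTs sTs'.
Qed.

(** The Steiner property excludes that [l] lists the same block twice: two
    copies would both contain any [t]-subset of it. *)
Lemma count_system t l (K : {set 'I_v}) : steiner_list t l -> #|K| = t.+1 ->
  count (fun s => K \subset points s) l = (K \in system l).
Proof.
move=> st_l cardK.
have eqK s : s \in l -> (K \subset points s) = (K == points s).
  move=> ls; rewrite eqEcard cardK (card_system st_l) ?leqnn ?andbT //.
  by rewrite inE map_f.
case Kl: (K \in system l); last first.
  apply/eqP; rewrite -leqn0 leqNgt -has_count; apply/hasP=> -[s ls].
  by rewrite eqK // => /eqP defK; rewrite inE defK map_f in Kl.
apply/eqP; rewrite eqn_leq -has_count andbC; apply/andP; split.
  by move: Kl; rewrite inE => /mapP[s ls ->]; apply/hasP; exists s.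
have [T [sTK cardT]] : exists T : {set 'I_v}, T \subset K /\ #|T| = t.
  have /card_gt0P[i Ki] : 0 < #|K| by rewrite cardK.
  exists (K :\ i); split; first exact: subD1set.
  by move: cardK; rewrite (cardsD1 i K) Ki => -[].
rewrite -[nat_of_bool true]/1 -(coversP (proj2 (andP st_l)) cardT).
by apply: sub_count => s; apply: subset_trans.
Qed.

(** As blocks have [t.+1] elements, a [t.+1]-set contained in a block is this
    block; so the multiplicity of the large set can be tested by containment. *)
Lemma large_set_systems t g (ls : seq (seq (seq nat))) :
  all (steiner_list t) ls -> covers g v t.+1 (flatten ls) ->
  large_set t g (map system ls).
Proof.
move=> /allP st_ls cov; split=> [_ /mapP[l /st_ls st_l ->]|K cardK].
  exact: steiner_system.
rewrite -(coversP cov cardK) count_flatten count_map -sumn_count.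
congr sumn; apply/eq_in_map => l /st_ls st_l.
by rewrite /= (count_system st_l cardK).
Qed.

End Lists.

(** * Large sets of Steiner systems S(5,6,12) with multiplicity 2 and 3 *)

(** The map x |-> a x + b of the projective line over Z/11, where 11 stands for
    the point at infinity. *)
Definition affine (a b x : nat) : nat :=
  if x < 11 then (a * x + b) %% 11 else x.

(** The images of the squares modulo 11 together with infinity,
    {1, 3, 4, 5, 9, oo}, under PSL(2,11) are the 132 blocks of an S(5,6,12).
    They are listed through their four orbits under the maps [affine a b] with
    [a] a nonzero square.  In each pair of representatives, the orbits consist
    of complementary hexads; the first pair is fixed by multiplication by
    squares, so there only the translations are applied. *)
Definition hexads : seq (seq nat) :=
  [seq map (affine 1 b) s
     | s <- [:: [:: 1; 3; 4; 5; 9; 11]; [:: 0; 2; 6; 7; 8; 10]], b <- iota 0 11]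
  ++ [seq map (affine m.1 m.2) s
     | s <- [:: [:: 0; 1; 2; 3; 5; 11]; [:: 0; 1; 2; 3; 4; 9]],
       m <- [seq (a, b) | a <- [:: 1; 3; 4; 5; 9], b <- iota 0 11]].

Definition relabel (f : nat -> nat) (l : seq (seq nat)) : seq (seq nat) :=
  map (map f) l.

(** The system [hexads] taken twice accounts for its own blocks, so the other
    twelve systems have no block in common with it and cover twice each of the
    792 remaining 6-sets.  The first of these twelve is the image under
    x |-> -x, and the others are the translates of a single relabelling, the
    6-cycle (0 1 3 4 5 2); this cycle was found by computer search. *)
Definition large_2 : seq (seq (seq nat)) :=
  [:: hexads; hexads; relabel (affine 10 0) hexads]
  ++ [seq relabel (affine 1 b \o next [:: 0; 1; 3; 4; 5; 2]) hexads
        | b <- iota 0 11].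

(** A single orbit of systems under the permutation (0 1 2 3 4 5 6)(9 10 11) of
    order 21.  Since 7 does not divide the order of M12, the automorphism group
    of S(5,6,12), every orbit of systems under this permutation has length 7 or
    21, and one suitable orbit of length 21 has the required number of systems.
    The transposition (2 8), found by computer search, moves [hexads] into such
    an orbit. *)
Definition large_3 : seq (seq (seq nat)) :=
  let rotation := next (iota 0 7) \o next [:: 9; 10; 11] in
  [seq relabel (iter i rotation \o next [:: 2; 8]) hexads | i <- iota 0 21].

Lemma steiner_large_2 : all (steiner_list 12 5) large_2.
Proof. by vm_compute. Qed.

Lemma covers_large_2 : covers 2 12 6 (flatten large_2).
Proof. by vm_compute. Qed.

Lemma steiner_large_3 : all (steiner_list 12 5) large_3.
Proof. by vm_compute. Qed.

Lemma covers_large_3 : covers 3 12 6 (flatten large_3).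
Proof. by vm_compute. Qed.

(** * Existence for every multiplicity at least 2 *)

Lemma large_set_exists g : 2 <= g ->
  exists2 Ds : seq {set {set 'I_12}}, large_set 5 g Ds & size Ds = 7 * g.
Proof.
elim/ltn_ind: g => -[|[|[|[|g]]]] // IHg _.
- exists (map (@system 12) large_2); last by rewrite size_map.
  exact: large_set_systems steiner_large_2 covers_large_2.
- exists (map (@system 12) large_3); last by rewrite size_map.
  exact: large_set_systems steiner_large_3 covers_large_3.
have [//|//|Ds large_Ds sz_Ds] := IHg g.+2.
exists (Ds ++ map (@system 12) large_2); last first.
  by rewrite size_cat sz_Ds size_map -[g.+4]addn2 mulnDr.
rewrite -[g.+4]addn2; apply: large_set_cat => //.
exact: large_set_systems steiner_large_2 covers_large_2.
Qed.

Theorem corollary5 (g : nat) (hg2 : 2 <= g)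
    (hg : g \notin [:: 3; 5; 7; 9; 11; 13]) :
  GDD_exists 5 6 (11 * g + 7 * g) [:: (g, 11); (7 * g, 1)] /\
  GDD_exists 6 7 (12 * g + 7 * g) [:: (g, 12); (7 * g, 1)].
Proof.
have [Ds large_Ds sz_Ds] := large_set_exists hg2.
case: g hg2 {hg} large_Ds sz_Ds => // g _ large_Ds sz_Ds; rewrite -sz_Ds.
have N_gt0 : 0 < size Ds by rewrite sz_Ds.
split; last by have := GDD_of_large_set N_gt0 large_Ds isT; rewrite card_ord.
rewrite -(size_map (@derived 11)) in N_gt0 *.
have := GDD_of_large_set N_gt0 (large_set_derived large_Ds) isT.
by rewrite card_ord.
Qed.
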